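(* Let $(P,\le)$ be a finite partially ordered set and $K$ a field. Let $R=K[x_I]$ be the polynomial ring with one variable $x_I$ for each irreducible upper set $I$ of $P$, and let $\mathrm{I}_{\mathrm{M}(P)}$ be the kernel of the $K$-algebra homomorphism $R\to K[\mathrm{M}(P)]$, $x_I\mapsto t^{\chi_I}$. Let $B$ be the set of binomials $$x_Ix_J-\prod_{U\in\mathcal{U}}x_U\prod_{V\in\mathcal{V}}x_V,$$ where $I,J$ range over pairs of irreducible upper sets such that $\{I,J\}$ is not a near-chain (i.e. $I\cap J\ne\emptyset$, $I\not\subseteq J$, $J\not\subseteq I$), and $I\cap J=\dot\bigcup_{U\in\mathcal{U}}U$, $I\cup J=\dot\bigcup_{V\in\mathcal{V}}V$ are the decompositions into disjoint irreducible upper sets. Then $B$ is a Gröbner basis of $\mathrm{I}_{\mathrm{M}(P)}$ with respect to the monomial order $\preceq$.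
   Context: $\mathrm{M}(P)$ is the monoid under pointwise addition of monotone functions $f:P\to\mathbb{N}$ (i.e. $a\le b\Rightarrow f(a)\le f(b)$). An upper set is an upward-closed subset of $P$; an irreducible upper set is a nonempty upper set that is not the union of two disjoint nonempty upper sets; every upper set is uniquely a disjoint union of irreducible upper sets. A near-chain is a set of irreducible upper sets any two of which are nested or disjoint. $\chi_I$ is the indicator function of $I$. $K[\mathrm{M}(P)]=\bigoplus_{f\in\mathrm{M}(P)}Kt^f$ with $t^ft^g=t^{f+g}$. The monomial order $\preceq$: give $x_I$ degree $|I|$, fix a total order on the variables refining the order by degree, and compare monomials first by total degree, then by the reverse lexicographic order induced by the order on variables. *)

(* Defs.v *)
From HB Require Import structures.
From mathcomp Require Import all_boot all_order all_algebra finmap.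
From mathcomp.multinomials Require Import monalg.

Set Implicit Arguments.
Unset Strict Implicit.
Unset Printing Implicit Defensive.

Import Order.TTheory GRing.Theory.

Local Open Scope ring_scope.

Section UpperSets.
Context {d : Order.disp_t} {P : finPOrderType d}.
Implicit Types S U : {set P}.

Definition upper_set U : bool :=
  [forall x, forall y, (x \in U) && (x <= y)%O ==> (y \in U)].

Definition irreducible_upper_set U : bool :=
  [&& upper_set U, U != set0 &
      ~~ [exists A : {set P}, exists B : {set P},
           [&& upper_set A, upper_set B, A != set0, B != set0,
               [disjoint A & B] & U == A :|: B]]].

End UpperSets.

Definition irr {d : Order.disp_t} (P : finPOrderType d) : predArgType :=
  {U : {set P} | irreducible_upper_set U}.

Section Families.
Context {d : Order.disp_t} {P : finPOrderType d}.

Definition near_chain (C : {set irr P}) : bool :=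
  [forall A in C, forall B in C,
    [|| val A \subset val B, val B \subset val A | [disjoint val A & val B]]].

Definition irr_decomposition (C : {set irr P}) (S : {set P}) : bool :=
  partition [set val A | A in C] S.

End Families.

Section MonotoneFunctions.
Context {d : Order.disp_t} (P : finPOrderType d).

Definition monotone_fun (f : {ffun P -> nat}) : bool :=
  [forall a, forall b, (a <= b)%O ==> (f a <= f b)%N].

Record mono : predArgType :=
  Mono { mono_val :> {ffun P -> nat}; mono_valP : monotone_fun mono_val }.

HB.instance Definition _ := [isSub for mono_val].
HB.instance Definition _ := [Choice of mono by <:].

Fact mono0_subproof : monotone_fun [ffun => 0%N].
Proof. by apply/'forall_forallP => a b; rewrite !ffunE; apply/implyP. Qed.

Fact monoD_subproof (f g : mono) : monotone_fun [ffun x => (f x + g x)%N].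
Proof.
apply/'forall_forallP => a b; apply/implyP => le_ab; rewrite !ffunE.
have mon (h : mono) : (h a <= h b)%N.
  by have /'forall_forallP/(_ a b)/implyP := mono_valP h; apply.
exact: leq_add.
Qed.

Definition mono0 : mono := Mono mono0_subproof.
Definition monoD (f g : mono) : mono := Mono (monoD_subproof f g).

Fact monoDA : associative monoD.
Proof. by move=> f g h; apply/val_inj/ffunP => x; rewrite /= !ffunE addnA. Qed.

Fact mono0D : left_id mono0 monoD.
Proof. by move=> f; apply/val_inj/ffunP => x; rewrite /= !ffunE. Qed.

Fact monoDC : commutative monoD.
Proof. by move=> f g; apply/val_inj/ffunP => x; rewrite /= !ffunE addnC. Qed.

Fact monoD0 : right_id mono0 monoD.
Proof. by move=> f; rewrite monoDC mono0D. Qed.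

Fact monoD_unit (f g : mono) : monoD f g = mono0 -> f = mono0 /\ g = mono0.
Proof.
move=> /(congr1 val)/ffunP fg0.
by split; apply/val_inj/ffunP => x; have /eqP := fg0 x; rewrite /= !ffunE addn_eq0;
   case/andP => /eqP ? /eqP ?.
Qed.

HB.instance Definition _ :=
  Choice_isMonomialDef.Build mono monoDA mono0D monoD0 monoD_unit.
HB.instance Definition _ := MonomialDef_isConomialDef.Build mono monoDC.

Fact indicator_subproof (I : irr P) :
  monotone_fun [ffun x => (x \in val I : nat)].
Proof.
apply/'forall_forallP => a b; apply/implyP => le_ab; rewrite !ffunE.
have /andP[/'forall_forallP/(_ a b)/implyP upI _] := valP I.
by case aI: (a \in val I) => //; rewrite upI // aI.
Qed.

Definition indicator (I : irr P) : mono := Mono (indicator_subproof I).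

End MonotoneFunctions.

Section ToricIdeal.
Context {d : Order.disp_t} (P : finPOrderType d) (K : fieldType).

(* The image of the monomial m under the map sending the variable of I to the
   element of the monoid algebra given by the indicator of I. *)
Definition toric_monomial (m : {cmonom (irr P)}) : {malg K[mono P]} :=
  \prod_(I : irr P) << indicator I >> ^+ m I.

Fact toric_monomial_is_mmorphism : mmorphism toric_monomial.
Proof.
split=> [m1 m2|]; rewrite /toric_monomial.
  by rewrite -big_split; apply: eq_bigr => I _; rewrite cmM exprD.
by rewrite big1 // => I _; rewrite cm1 expr0.
Qed.

HB.instance Definition _ := isMultiplicative.Build
  {cmonom (irr P)} {malg K[mono P]} toric_monomial toric_monomial_is_mmorphism.

Definition toric_map : {malg K[{cmonom (irr P)}]} -> {malg K[mono P]} :=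
  mmap (@malgC (mono P) K) toric_monomial.

HB.instance Definition _ := GRing.RMorphism.on toric_map.

Fact toric_map_is_scalable : scalable toric_map.
Proof.
by move=> c p; rewrite /toric_map mmapZ mul_malgC.
Qed.

HB.instance Definition _ := GRing.isScalable.Build
  K {malg K[{cmonom (irr P)}]} {malg K[mono P]} *:%R toric_map
  toric_map_is_scalable.

Definition Xvar (I : irr P) : {malg K[{cmonom (irr P)}]} := << ucm I >>.

Lemma toric_mapX (I : irr P) : toric_map (Xvar I) = << indicator I >>.
Proof.
rewrite /toric_map mmapU /= mul1r /toric_monomial (bigD1 I) //= cmUU expr1.
by rewrite big1 ?mulr1 // => J neJI; rewrite cmU eq_sym (negPf neJI) expr0.
Qed.

Definition toric_ideal (p : {malg K[{cmonom (irr P)}]}) : Prop :=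
  toric_map p = 0.

Definition toric_binomial (p : {malg K[{cmonom (irr P)}]}) : Prop :=
  exists (I J : irr P) (Us Vs : {set irr P}),
    [/\ ~~ near_chain [set I; J],
        irr_decomposition Us (val I :&: val J),
        irr_decomposition Vs (val I :|: val J)
      & p = Xvar I * Xvar J - (\prod_(U in Us) Xvar U) * \prod_(V in Vs) Xvar V].

End ToricIdeal.

Section MonomialOrder.
Context {d : Order.disp_t} {P : finPOrderType d}.

Definition variable_order (le : rel (irr P)) : Prop :=
  [/\ reflexive le, antisymmetric le, transitive le, total le
    & forall I J : irr P, (#|val I| < #|val J|)%N -> le I J].

(* Total degree for the grading in which the variable of I has degree #|I|. *)
Definition wdeg (m : {cmonom (irr P)}) : nat :=
  (\sum_(I : irr P) m I * #|val I|)%N.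

(* At the smallest variable on which the exponents differ, the monomial with
   the larger exponent is the smaller one. *)
Definition revlex_lt (le : rel (irr P)) (m1 m2 : {cmonom (irr P)}) : bool :=
  [exists I, (m2 I < m1 I)%N &&
     [forall J, le J I && (J != I) ==> (m1 J == m2 J)]].

Definition wrevlex (le : rel (irr P)) (m1 m2 : {cmonom (irr P)}) : bool :=
  [|| m1 == m2, (wdeg m1 < wdeg m2)%N
    | (wdeg m1 == wdeg m2) && revlex_lt le m1 m2].

End MonomialOrder.

Definition monomial_order (V : choiceType) (le : rel {cmonom V}) : Prop :=
  [/\ reflexive le, antisymmetric le, transitive le & total le] /\
  [/\ forall m, le mone m
    & forall m m1 m2, le m1 m2 -> le (mmul m1 m) (mmul m2 m)].

Section MonomialOrderTheory.
Context {d : Order.disp_t} {P : finPOrderType d} (le : rel (irr P)).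
Hypothesis le_var : variable_order le.
Implicit Types m : {cmonom (irr P)}.

Let ltv I J := le I J && (I != J).

Lemma wdegM m1 m2 : wdeg (mmul m1 m2) = (wdeg m1 + wdeg m2)%N.
Proof.
by rewrite /wdeg -big_split; apply: eq_bigr => I _; rewrite cmM mulnDl.
Qed.

Lemma wdeg1 : wdeg (mone : {cmonom (irr P)}) = 0%N.
Proof. by rewrite /wdeg big1 // => I _; rewrite cm1. Qed.

Lemma wdeg_eq0 m : wdeg m = 0%N -> m = mone.
Proof.
move=> /eqP; rewrite sum_nat_eq0 => /forallP m0; apply/eqP/cmP => I.
have /= := m0 I; rewrite muln_eq0 cards_eq0 cm1.
by have /and3P[_ /negPf -> _] := valP I; rewrite orbF => /eqP.
Qed.

Lemma revlexP m1 m2 :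
  reflect (exists2 I, (m2 I < m1 I)%N & forall J, ltv J I -> m1 J = m2 J)
          (revlex_lt le m1 m2).
Proof.
apply: (iffP existsP) => [[I /andP[lt12 /forallP eq12]]|[I lt12 eq12]].
  by exists I => // J ltJI; have /implyP/(_ ltJI)/eqP := eq12 J.
exists I; rewrite lt12; apply/forallP => J; apply/implyP => /eq12 ->.
exact/eqP.
Qed.

Lemma revlex_trans : transitive (revlex_lt le).
Proof.
have [_ asl trl tol _] := le_var.
move=> m2 m1 m3 /revlexP[I ltI eqI] /revlexP[J ltJ eqJ]; apply/revlexP.
have [eqIJ|neIJ] := eqVneq I J.
  subst J; exists I; first exact: ltn_trans ltJ ltI.
  by move=> J ltJI; rewrite eqI // eqJ.
have ltv_trans A B C : ltv A B -> ltv B C -> ltv A C.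
  move=> /andP[leAB neAB] /andP[leBC _]; rewrite /ltv (trl _ _ _ leAB leBC) /=.
  by apply: contra_neq neAB => eqAC; subst C; apply: asl; rewrite leAB.
case/orP: (tol I J) => [leIJ|leJI].
  have ltIJ : ltv I J by rewrite /ltv leIJ.
  exists I => [|A ltA]; first by rewrite -(eqJ I).
  by rewrite eqI // eqJ //; apply: ltv_trans ltIJ.
have ltJI : ltv J I by rewrite /ltv leJI eq_sym.
exists J => [|A ltA]; first by rewrite eqI.
by rewrite eqI ?eqJ //; apply: ltv_trans ltJI.
Qed.

Lemma revlex_irr m : revlex_lt le m m = false.
Proof. by apply/revlexP => -[I]; rewrite ltnn. Qed.

Lemma revlex_total m1 m2 : m1 != m2 -> revlex_lt le m1 m2 || revlex_lt le m2 m1.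
Proof.
have [rfl asl trl tol _] := le_var.
move=> ne12; have [I0 neI0] : exists I, m1 I != m2 I.
  apply/existsP; apply: contraR ne12; rewrite negb_exists => /forallP eq12.
  by apply/cmP => I; apply/eqP; have := eq12 I; rewrite negbK.
pose D := [pred I | m1 I != m2 I].
have [I neI minI] : exists2 I, D I & forall J, D J -> le I J.
  pose s := sort le (enum D).
  have ms : s =i D by move=> I; rewrite mem_sort mem_enum.
  have := sort_sorted tol (enum D); rewrite -/s.
  case: {1 2}s (ms) => [|I s'] ms' srt.
    by have := ms' I0; rewrite inE [in RHS]inE neI0.
  exists I; first by have := ms' I; rewrite inE eqxx.
  move=> J DJ; have : J \in I :: s' by rewrite ms'.
  rewrite inE => /predU1P[->//|]; move: srt; rewrite /= path_sortedE //.
  by case/andP=> /allP h _ /h.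
have eqI J : ltv J I -> m1 J = m2 J.
  move=> /andP[leJI neJI]; apply/eqP; apply: contraR neJI => neJ.
  by apply/eqP/asl; rewrite leJI minI.
move: neI; rewrite /= neq_ltn => /orP[lt|lt]; apply/orP.
  by right; apply/revlexP; exists I => // J /eqI.
by left; apply/revlexP; exists I.
Qed.

Lemma wrevlex_monomial_order : monomial_order (wrevlex le).
Proof.
have irrw m1 m2 : wrevlex le m1 m2 = (m1 == m2) ||
    ((wdeg m1 < wdeg m2)%N || ((wdeg m1 == wdeg m2) && revlex_lt le m1 m2)).
  by [].
split; split.
- by move=> m; rewrite irrw eqxx.
- move=> m1 m2; rewrite !irrw.
  have [//|_ /=] := eqVneq m1 m2; case: ltngtP => //= _.
  by case/andP=> l12 /(revlex_trans l12); rewrite revlex_irr.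
- move=> m2 m1 m3; rewrite !irrw.
  have [->//|_ /=] := eqVneq m1 m2; have [<-|_ /=] := eqVneq m2 m3.
    by move=> -> _; rewrite orbT.
  case: (ltngtP (wdeg m1)) => //= [lt12|eq12] l12.
    by case: (ltngtP (wdeg m2)) => //= [lt23 _|<- _];
      rewrite ?(ltn_trans lt12 lt23) ?lt12 !orbT.
  rewrite -eq12 in l12 *; case: ltngtP => //= [_ _|_ l23]; rewrite ?orbT //.
  by rewrite (revlex_trans l12 l23) orbT.
- move=> m1 m2; rewrite !irrw; have [//|ne12] := eqVneq m1 m2.
  case: ltngtP => //= _; exact: revlex_total.
- move=> m; rewrite irrw wdeg1; have [/wdeg_eq0 ->|] := posnP (wdeg m).
    by rewrite eqxx.
  by rewrite orbT.
- move=> m m1 m2; rewrite !irrw => /predU1P[->|]; first by rewrite eqxx.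
  rewrite !wdegM ltn_add2r eqn_add2r => /orP[->|/andP[-> /revlexP[I lt eq]]].
    by rewrite orbT.
  rewrite [X in _ || (_ || X)](_ : _ = true) ?orbT //=; apply/revlexP.
  by exists I => [|J /eq]; rewrite !cmM ?ltn_add2r // => ->.
Qed.

End MonomialOrderTheory.

Section Groebner.
Context {V : choiceType} {K : fieldType}.
Implicit Types S G I : {malg K[{cmonom V}]} -> Prop.

Definition ideal_gen S (p : {malg K[{cmonom V}]}) : Prop :=
  exists2 s : seq ({malg K[{cmonom V}]} * {malg K[{cmonom V}]}),
    {in s, forall q, S q.2} & p = \sum_(q <- s) q.1 * q.2.

Definition leading_monomial (le : rel {cmonom V})
    (p : {malg K[{cmonom V}]}) (m : {cmonom V}) : Prop :=
  m \in msupp p /\ {in msupp p, forall m', le m' m}.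

Definition initial_ideal (le : rel {cmonom V}) S :
    {malg K[{cmonom V}]} -> Prop :=
  ideal_gen (fun q => exists p m,
    [/\ S p, leading_monomial le p m & q = << m >>]).

Definition groebner_basis (le : rel {cmonom V}) I G : Prop :=
  [/\ exists s : seq {malg K[{cmonom V}]}, forall p, G p <-> p \in s,
      forall p, G p -> I p
    & forall p, initial_ideal le I p <-> initial_ideal le G p].

End Groebner.

(* Main.v *)
(** The monomial x_I x_J leads its binomial because every U inside I :&: J is
    smaller than I and J, while both sides have the same weight.  Conversely,
    a monomial supported on a near-chain is strictly smaller than every other
    monomial with the same image in the monoid algebra.  The leading monomial of
    a nonzero element of the toric ideal shares its image with another monomial
    of the support, so it is not supported on a near-chain, which makes it a
    multiple of some x_I x_J leading a binomial. *)

Require Import Defs.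
From mathcomp Require Import all_boot all_order all_algebra.
From mathcomp Require Import finmap zify.
From mathcomp.multinomials Require Import monalg.

Set Implicit Arguments.
Unset Strict Implicit.
Unset Printing Implicit Defensive.

Import Order.TTheory GRing.Theory.

Local Open Scope ring_scope.

(** * Monomials and their coefficients in monoid algebras *)

Lemma malgUM (M : monomType) (R : nzRingType) (m1 m2 : M) :
  << mmul m1 m2 >> = << m1 >> * << m2 >> :> {malg R[M]}.
Proof. by rewrite malgM_def fgmulUU mulr1. Qed.

Lemma malgU_prod (M : monomType) (R : nzRingType) (T : Type) (r : seq T)
    (Q : pred T) (F : T -> M) :
  \prod_(i <- r | Q i) << F i >> =
  << \big[@mmul M/@mone M]_(i <- r | Q i) F i >> :> {malg R[M]}.
Proof. by rewrite (big_morph _ (@malgUM M R) (erefl _)). Qed.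

Lemma sum_eq_nat (T : finType) (A : {set T}) (x : T) :
  (\sum_(y in A) (y == x) = (x \in A))%N.
Proof.
case xA: (x \in A).
  by rewrite (bigD1 x) //= eqxx big1 ?addn0 // => y /andP[_ /negPf->].
by rewrite big1 // => y yA; have [eyx|//] := eqVneq y x; rewrite -eyx yA in xA.
Qed.

Lemma prod_ucmE (V : finType) (A : {set V}) (i : V) :
  (\big[@mmul {cmonom V}/mone]_(j in A) ucm j) i = (i \in A).
Proof.
rewrite (big_morph (fun m : {cmonom V} => m i) (fun m1 m2 => cmM i m1 m2) (cm1 i)).
by rewrite -sum_eq_nat; apply: eq_bigr => j _; rewrite cmU.
Qed.

Lemma ucm2E (V : choiceType) (i j k : V) :
  (mmul (ucm i) (ucm j)) k = ((i == k) + (j == k))%N.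
Proof. exact: etrans (cmM k _ _) (congr2 addn (cmU i k) (cmU j k)). Qed.

Lemma divcmK (V : choiceType) (m n : {cmonom V}) :
  (forall i, n i <= m i)%N -> mmul (divcm m n) n = m.
Proof. by move=> le_nm; apply/eqP/cmP => i; rewrite cmM divcmE subnK. Qed.

Lemma leading_monomialB (V : choiceType) (K : fieldType) (le : rel {cmonom V})
    (m1 m2 : {cmonom V}) :
  m2 != m1 -> le m1 m1 -> le m2 m1 ->
  leading_monomial le (<< m1 >> - << m2 >> : {malg K[_]}) m1.
Proof.
move=> ne21 le11 le21; split=> [|m /(fsubsetP (msuppB_le _ _))].
  have coef1 : (<< m1 >> - << m2 >>)@_m1 = 1 :> K.
    apply: etrans (mcoeffB _ _ _) _.
    apply: etrans (congr2 (fun a b => a - b) (mcoeffU1 K m1 _) (mcoeffU1 K m2 _)) _.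
    by rewrite eqxx (negPf ne21) subr0.
  by rewrite -mcoeff_neq0 coef1 oner_eq0.
by rewrite in_fsetU; case/orP; rewrite msuppU1 => /fset1P->.
Qed.

(** * Irreducible upper sets, their disjoint decompositions and near-chains *)

Section UpperSets.
Context {d : Order.disp_t} {P : finPOrderType d}.
Implicit Types (S W : {set P}) (I J : irr P) (C : {set irr P}).

Lemma upper_setP S :
  reflect (forall x y, x \in S -> (x <= y)%O -> y \in S) (upper_set S).
Proof.
apply: (iffP 'forall_forallP) => upS x y.
  by move=> xS le_xy; have /implyP := upS x y; apply; rewrite xS.
by apply/implyP => /andP[]; apply: upS.
Qed.

Lemma irr_upper I : upper_set (val I).
Proof. by case/and3P: (valP I). Qed.

Lemma irr_neq0 I : val I != set0.
Proof. by case/and3P: (valP I). Qed.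

Lemma upper_setI S W : upper_set S -> upper_set W -> upper_set (S :&: W).
Proof.
move=> /upper_setP upS /upper_setP upW; apply/upper_setP => x y.
rewrite !inE => /andP[xS xW] le_xy.
by rewrite (upS _ _ xS le_xy) (upW _ _ xW le_xy).
Qed.

Lemma upper_setU S W : upper_set S -> upper_set W -> upper_set (S :|: W).
Proof.
move=> /upper_setP upS /upper_setP upW; apply/upper_setP => x y.
rewrite !inE => /orP[xS|xW] le_xy; apply/orP; [left | right].
  exact: upS le_xy.
exact: upW le_xy.
Qed.

(* An irreducible upper set is connected: if W meets I without containing it, some
   comparability inside I crosses the boundary of W. *)
Lemma irr_crossing I W : upper_set W -> val I :&: W != set0 ->
  ~~ (val I \subset W) ->
  exists y z, [/\ y \in val I, y \notin W, z \in W & (y <= z)%O].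
Proof.
move=> upW IW0 nIW.
have [/existsP[y /existsP[z /and4P[? ? ? ?]]]|] :=
  boolP [exists y, exists z, [&& y \in val I, y \notin W, z \in W & (y <= z)%O]].
  by exists y, z.
rewrite negb_exists => /forallP noyz.
have /and3P[upI _ /negP[]] := valP I.
apply/existsP; exists (val I :&: W); apply/existsP; exists (val I :\: W).
rewrite upper_setI // IW0 setD_eq0 nIW setID eqxx andbT /=.
apply/andP; split; last first.
  by rewrite -setI_eq0; apply/eqP/setP => y; rewrite !inE; do 2!case: (y \in _).
apply/upper_setP => y z; rewrite !inE => /andP[yW yI] le_yz.
have /upper_setP/(_ y z yI le_yz) -> := upI; rewrite andbT.
by have := noyz y; rewrite negb_exists => /forallP/(_ z); rewrite yI yW le_yz andbT.
Qed.

Lemma irr_decomposition_exists S : upper_set S -> exists C, irr_decomposition C S.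
Proof.
(* Strong induction on the size: a reducible upper set splits into two nonempty, hence strictly
   smaller, pieces. *)
move: {2}#|S| (leqnn #|S|) => n; elim: n S => [|n IHn] S leSn upS.
  exists set0; rewrite /irr_decomposition imset0.
  by move: leSn; rewrite leqn0 cards_eq0 => /eqP->; rewrite partition_set0.
have [S0|S0] := eqVneq S set0.
  by exists set0; rewrite /irr_decomposition imset0 S0 partition_set0.
have [irrS|] := boolP (irreducible_upper_set S).
  exists [set exist _ S irrS]; rewrite /irr_decomposition imset_set1 /=.
  rewrite /partition cover1 eqxx /= inE eq_sym S0 andbT.
  by apply/trivIsetP => A B /set1P-> /set1P->; rewrite eqxx.
rewrite /irreducible_upper_set upS S0 negbK /= => /existsP[A /existsP[B]].
case/and5P=> upA upB A0 B0 /andP[disAB /eqP defS].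
have cardS : (#|A| + #|B| = #|S|)%N.
  by have := cardsUI A B; rewrite -defS (disjoint_setI0 disAB) cards0 addn0 => ->.
move: A0 B0; rewrite -!card_gt0 => A0 B0.
have [CA /and3P[/eqP covA trA nA]] := IHn A ltac:(lia) upA.
have [CB /and3P[/eqP covB trB nB]] := IHn B ltac:(lia) upB.
exists (CA :|: CB); rewrite /irr_decomposition imsetU /partition.
rewrite /cover bigcup_setU -!/(cover _) covA covB -defS eqxx inE negb_or nA nB.
by rewrite trivIsetU ?covA ?covB.
Qed.

(** Each point of [S] lies in exactly one block of the partition; injectivity of [val] carries the
    sum from the blocks to [C]. *)
Lemma irr_decomposition_sum C S x : irr_decomposition C S ->
  (\sum_(U in C) (x \in val U) = (x \in S))%N.
Proof.
move=> /and3P[/eqP defS trC _]; rewrite -defS -sum_eq_nat (big_trivIset _ trC) /=.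
rewrite big_imset /=; last by move=> U V _ _; apply: val_inj.
by apply: eq_bigr => U _; rewrite sum_eq_nat.
Qed.

(** The condition concerns pairs only, so a failure is localized at two members; applied to the
    support of a leading monomial, they supply the pair I, J. *)
Lemma not_near_chainP C :
  reflect (exists I J, [/\ I \in C, J \in C & ~~ near_chain [set I; J]])
          (~~ near_chain C).
Proof.
apply: (iffP idP) => [|[I [J [IC JC]]]].
  case/forall_inPn=> I IC /forall_inPn[J JC nIJ]; exists I, J; split=> //.
  apply: contra nIJ => /forall_inP/(_ I); rewrite !inE eqxx => /(_ isT).
  by move=> /forall_inP/(_ J); rewrite !inE eqxx orbT; apply.
apply: contra => /forall_inP ncC; apply/forall_inP => A AIJ.
apply/forall_inP => B BIJ; have subC : {subset [set I; J] <= C}.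
  by move=> D /set2P[]->.
by have /forall_inP := ncC A (subC _ AIJ); apply; apply: subC.
Qed.

Lemma not_near_chain2 I J : ~~ near_chain [set I; J] ->
  [/\ ~~ (val I \subset val J), ~~ (val J \subset val I)
    & val I :&: val J != set0].
Proof.
move=> ncIJ; have : ~~ [|| val I \subset val J, val J \subset val I
                         | [disjoint val I & val J]].
  apply: contra ncIJ => cIJ; apply/forall_inP => A /set2P[]->;
    apply/forall_inP => B /set2P[]->; rewrite ?subxx //.
  by rewrite disjoint_sym orbCA.
by rewrite !negb_or setI_eq0 => /and3P[].
Qed.

(** Makes x_I x_J squarefree, so that it divides every monomial with positive exponents at I and
    J. *)
Lemma not_near_chain_neq I J : ~~ near_chain [set I; J] -> I != J.
Proof. by case/not_near_chain2=> nIJ _ _; apply: contraNneq nIJ => ->. Qed.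

End UpperSets.

(** * Images of monomials in the monoid algebra *)

Section ToricMonomials.
Context {d : Order.disp_t} {P : finPOrderType d}.
Implicit Types (m : {cmonom (irr P)}) (I J : irr P).

(** The f such that x^m has image t^f. Since [mmul] on [mono P] is pointwise addition, the inner
    product stands for [m I] copies of the indicator. *)
Definition toric_exponent m : mono P :=
  \big[@mmul (mono P)/mone]_(I : irr P)
    \big[@mmul (mono P)/mone]_(k < m I) indicator I.

Lemma mono_prodE (T : Type) (r : seq T) (Q : pred T) (F : T -> mono P) x :
  (\big[@mmul (mono P)/mone]_(i <- r | Q i) F i) x =
  (\sum_(i <- r | Q i) F i x)%N.
Proof.
have mulE (f g : mono P) : mmul f g x = (f x + g x)%N by rewrite /= ffunE.
by apply: (big_morph (fun f : mono P => f x) mulE); rewrite /= ffunE.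
Qed.

Lemma toric_exponentE m x :
  toric_exponent m x = (\sum_(I : irr P) m I * (x \in val I))%N.
Proof.
rewrite mono_prodE; apply: eq_bigr => I _; rewrite mono_prodE.
by rewrite sum_nat_const card_ord ffunE.
Qed.

Lemma toric_exponentM m1 m2 x :
  toric_exponent (mmul m1 m2) x = (toric_exponent m1 x + toric_exponent m2 x)%N.
Proof.
rewrite !toric_exponentE -big_split; apply: eq_bigr => I _.
by rewrite cmM mulnDl.
Qed.

Lemma toric_exponent_prod (C : {set irr P}) x :
  toric_exponent (\big[@mmul {cmonom (irr P)}/mone]_(U in C) ucm U) x =
  (\sum_(U in C) (x \in val U))%N.
Proof.
rewrite toric_exponentE [RHS]big_mkcond; apply: eq_bigr => I _.
by rewrite prod_ucmE; case: (I \in C); rewrite (mul1n, mul0n).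
Qed.

Lemma toric_exponentU I x : toric_exponent (ucm I) x = (x \in val I).
Proof. by have := toric_exponent_prod [set I] x; rewrite !big_set1. Qed.

(** Double counting of the pairs (I, x) with x in I. Monomials with the same image thus have equal
    weight, and only the reverse lexicographic part of [wrevlex] separates them. *)
Lemma wdeg_toric_exponent m : wdeg m = (\sum_x toric_exponent m x)%N.
Proof.
under [RHS]eq_bigr do rewrite toric_exponentE.
rewrite exchange_big; apply: eq_bigr => I _; rewrite -big_distrr /= -sum1_card.
by rewrite big_mkcond; congr (_ * _)%N; apply: eq_bigr => x _; case: (x \in _).
Qed.

Lemma toric_monomialE (K : fieldType) m :
  toric_monomial K m = << toric_exponent m >>.
Proof.
rewrite /toric_monomial -malgU_prod; apply: eq_bigr => I _.
by rewrite -malgU_prod prodr_const card_ord.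
Qed.

Lemma toric_mapU (K : fieldType) m :
  toric_map << m >> = << toric_exponent m >> :> {malg K[mono P]}.
Proof. by rewrite /toric_map mmapU mul1r /= toric_monomialE. Qed.

Lemma mcoeff_toric_map (K : fieldType) (p : {malg K[{cmonom (irr P)}]}) f :
  (toric_map p)@_f =
  \sum_(m <- msupp p) p@_m * (toric_exponent m == f)%:R.
Proof.
rewrite /toric_map mmapE raddf_sum; apply: eq_bigr => m _.
by rewrite /= toric_monomialE mcoeffCM mcoeffU1.
Qed.

(** * The binomial of a pair that is not a near-chain *)

Section Binomials.
Variables (I J : irr P) (Us Vs : {set irr P}).
Hypotheses (ncIJ : ~~ near_chain [set I; J])
           (decU : irr_decomposition Us (val I :&: val J))
           (decV : irr_decomposition Vs (val I :|: val J)).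

Let m1 : {cmonom (irr P)} := mmul (ucm I) (ucm J).
Let m2 : {cmonom (irr P)} :=
  mmul (\big[@mmul {cmonom (irr P)}/mone]_(U in Us) ucm U)
       (\big[@mmul {cmonom (irr P)}/mone]_(V in Vs) ucm V).

Lemma binomialE (K : fieldType) :
  Xvar K I * Xvar K J - (\prod_(U in Us) Xvar K U) * \prod_(V in Vs) Xvar K V =
  << m1 >> - << m2 >>.
Proof. by rewrite !malgUM -!malgU_prod. Qed.

(** Inclusion-exclusion for indicators: those of I and J add up to those of the intersection and the
    union, each of which is the sum over its components. *)
Lemma binomial_exponent : toric_exponent m1 = toric_exponent m2.
Proof.
apply/val_inj/ffunP => x.
suff : toric_exponent m1 x = toric_exponent m2 x by [].
transitivity ((x \in val I) + (x \in val J))%N.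
  exact: etrans (toric_exponentM _ _ x)
                (congr2 addn (toric_exponentU I x) (toric_exponentU J x)).
transitivity (\sum_(U in Us) (x \in val U) + \sum_(V in Vs) (x \in val V))%N.
  rewrite (irr_decomposition_sum _ decU) (irr_decomposition_sum _ decV).
  by rewrite in_setI in_setU; do 2!case: (x \in _).
exact/esym/(etrans (toric_exponentM _ _ x))/(congr2 addn
  (toric_exponent_prod Us x) (toric_exponent_prod Vs x)).
Qed.

Lemma binomial_revlex (le : rel (irr P)) :
  variable_order le -> revlex_lt le m2 m1.
Proof.
move=> le_var; have [_ _ _ _ le_card] := le_var.
have [nIJ nJI IJ0] := not_near_chain2 ncIJ.
have /and3P[/eqP covU _ _] := decU.
have /set0Pn[x] := IJ0; rewrite -covU => /bigcupP[A /imsetP[U UUs defA] _].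
have subU : val U \subset val I :&: val J.
  by rewrite -covU -defA /cover (bigcup_sup A) // defA imset_f.
have [ltUI ltUJ] : (#|val U| < #|val I|)%N /\ (#|val U| < #|val J|)%N.
  move: subU; rewrite subsetI => /andP[UI UJ]; split; apply: proper_card.
    rewrite properE UI; apply: contra nIJ => IU; exact: subset_trans IU UJ.
  rewrite properE UJ; apply: contra nJI => JU; exact: subset_trans JU UI.
have neqU (W : irr P) : (#|val U| < #|val W|)%N -> (U == W) = false.
  by apply: contraTF => /eqP->; rewrite ltnn.
have m1E W : m1 W = ((I == W) + (J == W))%N := ucm2E I J W.
have m2E W : m2 W = ((W \in Us) + (W \in Vs))%N.
  exact: etrans (cmM W _ _) (congr2 addn (prod_ucmE Us W) (prod_ucmE Vs W)).
have m1U : m1 U = 0%N by rewrite m1E eq_sym neqU // eq_sym neqU.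
have m2U : (0 < m2 U)%N by rewrite m2E UUs.
(* If [m1] were smaller, the first variable W with differing exponents would occur in [m1], so W
   would be I or J and come after U; but U occurs in [m2] only. *)
have : m1 != m2 by apply: contraTneq m2U => <-; rewrite m1U.
case/(revlex_total le_var)/orP=> // /revlexP[W ltW eqW].
have ltUW : (#|val U| < #|val W|)%N.
  have : (0 < m1 W)%N by apply: leq_ltn_trans ltW.
  rewrite m1E; have [<-//|_] := eqVneq I W.
  by have [<-|] := eqVneq J W.
have : m1 U = m2 U by apply: eqW; rewrite le_card // neqU.
by rewrite m1U => m2U0; rewrite -m2U0 in m2U.
Qed.

Lemma binomial_leading (K : fieldType) (le : rel (irr P)) :
  variable_order le ->
  leading_monomial (wrevlex le) (<< m1 >> - << m2 >> : {malg K[_]}) m1.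
Proof.
move=> le_var; have lt21 := binomial_revlex le_var.
have ne21 : m2 != m1.
  by apply: contraTneq lt21 => ->; rewrite revlex_irr.
apply: leading_monomialB; rewrite ?ne21 // /wrevlex ?eqxx // lt21.
by rewrite !wdeg_toric_exponent binomial_exponent eqxx !orbT.
Qed.

End Binomials.

(* Suppose m' is smaller, let W be the first variable where the exponents differ,
   and cancel the common factors.  At a maximum x in W of the common exponent function g, let I be the
   smallest remaining factor of m containing x: g is at least g x on I, and I is
   not inside W, hence some y in I outside W lies below some z in W.  Counting
   the factors of m' gives g y < g z, contradicting the choice of x. *)
Lemma near_chain_revlex_min (le : rel (irr P)) m m' :
  variable_order le -> near_chain [set I | 0 < m I]%N ->
  toric_exponent m' = toric_exponent m -> ~~ revlex_lt le m' m.
Proof.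
move=> [_ _ _ _ le_card] ncm eqm; apply/revlexP => -[W ltW eqW].
pose a I := (m I - m' I)%N; pose b I := (m' I - m I)%N.
pose g x := (\sum_I a I * (x \in val I))%N.
have gE x : g x = (\sum_I b I * (x \in val I))%N.
  have := congr1 (fun f : mono P => f x) eqm; rewrite /= !toric_exponentE => eqx.
  (* Adding the common image to both sides turns both coefficients at I into the maximum of [m I]
     and [m' I], because the subtractions are truncated. *)
  apply: (@addnI (\sum_I m' I * (x \in val I))); rewrite {2}eqx -!big_split /=.
  by apply: eq_bigr => I _; rewrite -!mulnDl /a /b; congr (_ * _)%N; rewrite -!maxnE maxnC.
(* A proper subset J of W is smaller, hence precedes W, and there the exponents agree; at W itself
   [m'] has the larger exponent. *)
have a_sub J : val J \subset val W -> a J = 0%N.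
  move=> sJW; rewrite /a; have [->|neJW] := eqVneq J W; first lia.
  rewrite eqW ?subnn // neJW le_card // proper_card // properEneq sJW andbT.
  by apply: contra neJW => /eqP/val_inj->.
have /set0Pn[x0 x0W] := irr_neq0 W.
pose x := [arg max_(z > x0 in val W) g z].
have [xW xmax] : x \in val W /\ forall z, z \in val W -> (g z <= g x)%N.
  by rewrite /x; case: arg_maxnP.
(* The factor W has [b W > 0] and contains x, so [g x] is positive and some remaining factor of m
   contains x. *)
have [I0 I0P] : exists I0, (0 < a I0)%N && (x \in val I0).
  apply/existsP; apply: contraTT (_ : (0 < g x)%N).
    rewrite negb_exists => /forallP a0; rewrite -leqNgt leqn0 sum_nat_eq0.
    apply/forallP => I; have := a0 I.
    by rewrite negb_and -leqNgt leqn0 /=; case: (x \in _); rewrite ?muln1 ?muln0 ?orbF.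
  rewrite gE (bigD1 W) //= xW /b; lia.
pose I := [arg min_(J < I0 | (0 < a J)%N && (x \in val J)) #|val J|].
have [/andP[aI xI] minI] : (0 < a I)%N && (x \in val I) /\
    forall J, (0 < a J)%N && (x \in val J) -> (#|val I| <= #|val J|)%N.
  by rewrite /I; case: arg_minnP.
have a_supp J : (0 < a J)%N -> J \in [set J | 0 < m J]%N.
  by rewrite inE /a; lia.
(* Any remaining factor J of m containing x meets I, so the two are nested; minimality of I gives I
   inside J, so J also counts at y. *)
have le_g y : y \in val I -> (g x <= g y)%N.
  move=> yI; apply: leq_sum => J _; rewrite leq_mul2l; apply/orP.
  case: (posnP (a J)) => [_|aJ]; [by left | right].
  case xJ: (x \in val J) => //; suff -> : y \in val J by [].
  have /forall_inP/(_ I (a_supp _ aI))/forall_inP/(_ J (a_supp _ aJ)) := ncm.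
  case/or3P=> [/subsetP->//|sJI|/pred0P/(_ x)]; last by rewrite /= xI xJ.
  have /eqP-> // : val J == val I.
  by rewrite eqEcard sJI minI // aJ.
have [y [z [yI yW zW le_yz]]] : exists y z,
    [/\ y \in val I, y \notin val W, z \in val W & (y <= z)%O].
  apply: irr_crossing (irr_upper W) _ _; first by apply/set0Pn; exists x; rewrite inE xI.
  by apply: contraTN aI => /a_sub->.
suff : (g y < g z)%N by have := xmax z zW; have := le_g y yI; lia.
(* W counts [b W > 0] at z and nothing at y; every other factor containing y contains z, being an
   upper set. *)
rewrite !gE (bigD1 W) // [X in (_ < X)%N](bigD1 W) //= (negPf yW) zW muln0 add0n.
rewrite -add1n leq_add //; first by rewrite /b; lia.
apply: leq_sum => J _; rewrite leq_mul2l; apply/orP; right.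
by case yJ: (y \in val J) => //; have /upper_setP/(_ y z yJ le_yz)-> := irr_upper J.
Qed.

Lemma toric_leading_not_near_chain (K : fieldType) (le : rel (irr P))
    (p : {malg K[{cmonom (irr P)}]}) m :
  variable_order le -> toric_ideal p -> leading_monomial (wrevlex le) p m ->
  ~~ near_chain [set I | 0 < m I]%N.
Proof.
move=> le_var p0 [mp maxm]; apply/negP => ncm.
(* This coefficient of the zero image sums the coefficients of p over the fibre of m. Minimality of
   m in its fibre and maximality in the support leave only the nonzero coefficient at m. *)
have := mcoeff_toric_map p (toric_exponent m).
rewrite p0 mcoeff0 (big_fsetD1 m) //= eqxx mulr1 big_seq big1 => [/esym/eqP|m'].
  by rewrite addr0 mcoeff_eq0 mp.
rewrite !inE => /andP[nem m'p].
have [eqm|_] := eqVneq; last by rewrite mulr0.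
have /negPf nlt := near_chain_revlex_min le_var ncm eqm.
have := maxm _ m'p.
by rewrite /wrevlex (negPf nem) nlt andbF orbF !wdeg_toric_exponent eqm ltnn.
Qed.

End ToricMonomials.

(** * Comparison of initial ideals and the Gröbner basis property *)

Lemma ideal_gen_closed (V : choiceType) (K : fieldType)
    (S T : {malg K[{cmonom V}]} -> Prop) :
  (forall q, S q -> exists c q', T q' /\ q = c * q') ->
  forall p, ideal_gen S p -> ideal_gen T p.
Proof.
move=> ST p [s sS ->]; elim: s sS => [|[c q] s IHs] sS.
  by exists [::] => //; rewrite !big_nil.
have [|t tT eqt] := IHs; first by move=> r rs; apply: sS; rewrite inE rs orbT.
have [|c' [q' [Tq' /= ->]]] := ST q; first exact: (sS (c, q) (mem_head _ _)).
exists ((c * c', q') :: t); last by rewrite !big_cons eqt /= mulrA.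
by move=> r; rewrite inE => /predU1P[->|/tT].
Qed.

Theorem theorem5 (d : Order.disp_t) (P : finPOrderType d) (K : fieldType)
    (le : rel (irr P)) (le_var : variable_order le) :
  groebner_basis (wrevlex le) (@toric_ideal d P K) (@toric_binomial d P K).
Proof.
have subB p : @toric_binomial d P K p -> toric_ideal p.
  move=> [I [J [Us [Vs [_ decU decV ->]]]]]; rewrite /toric_ideal binomialE.
  rewrite raddfB; apply/eqP; rewrite subr_eq0; apply/eqP.
  apply: etrans (toric_mapU _ _) (etrans _ (esym (toric_mapU _ _))).
  by rewrite (binomial_exponent decU decV).
split=> // [|p].
  (* Finiteness of the set of binomials: they are indexed by a decidable subset of a finite type of
     quadruples. *)
  pose T := [the finType of (irr P * irr P * {set irr P} * {set irr P})%type].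
  exists [seq Xvar K t.1.1.1 * Xvar K t.1.1.2 -
            (\prod_(U in t.1.2) Xvar K U) * \prod_(V in t.2) Xvar K V
         | t : T <- enum T & [&& ~~ near_chain [set t.1.1.1; t.1.1.2],
             irr_decomposition t.1.2 (val t.1.1.1 :&: val t.1.1.2)
           & irr_decomposition t.2 (val t.1.1.1 :|: val t.1.1.2)]] => p.
  split=> [[I [J [Us [Vs [ncIJ decU decV ->]]]]]|/mapP[[[[I J] Us] Vs]]].
    apply/mapP; exists (I, J, Us, Vs) => //.
    by rewrite mem_filter mem_enum /= ncIJ decU decV.
  by rewrite mem_filter => /andP[/and3P[? ? ?] _] ->; exists I, J, Us, Vs.
(* Leading monomials of binomials are leading monomials of kernel elements by [subB]; the other
   inclusion needs a binomial whose leading monomial divides m. *)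
split; apply: ideal_gen_closed => q [p' [m [Bp' lead ->]]]; last first.
  by exists 1, << m >>; split; [exists p', m; split; auto | rewrite mul1r].
have /not_near_chainP[I [J []]] := toric_leading_not_near_chain le_var Bp' lead.
rewrite !inE => mI mJ ncIJ; have neIJ := not_near_chain_neq ncIJ.
have [Us decU] := irr_decomposition_exists (upper_setI (irr_upper I) (irr_upper J)).
have [Vs decV] := irr_decomposition_exists (upper_setU (irr_upper I) (irr_upper J)).
(* The cofactor is the quotient of m by x_I x_J, exact because I and J are distinct and both occur
   in m. *)
exists << divcm m (mmul (ucm I) (ucm J)) >>, << mmul (ucm I) (ucm J) >>; split.
  exists (<< mmul (ucm I) (ucm J) >> -
    << mmul (\big[@mmul {cmonom (irr P)}/mone]_(U in Us) ucm U)
            (\big[@mmul {cmonom (irr P)}/mone]_(V in Vs) ucm V) >>).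
  exists (mmul (ucm I) (ucm J)); split=> //; last exact: binomial_leading.
  by exists I, J, Us, Vs; split=> //; rewrite binomialE.
rewrite -malgUM divcmK // => L; rewrite ucm2E.
have [<-|_] := eqVneq I L; first by rewrite eq_sym (negPf neIJ).
by case: eqVneq => // <-.
Qed.
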